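(* Let $N$ be a positive integer, $k\geq 1$ an integer, $a,c\in\mathbb{C}$ and $|q|<1$. Then \[ \sum_{n=0}^{\infty}c^n \binom{k+n-1}{n}\left( (aq^n)_{N} - 1\right)=\sum_{n=1}^{\infty}\frac{(-a)^n q^{n(n-1)/2}}{(q)_n(1-c q^n)^k}(q^{N-n+1})_n. \]
   Context: For $x\in\mathbb{C}$ and $n\ge 0$, $(x)_n=(x;q)_n=\prod_{j=0}^{n-1}(1-xq^j)$, with $(x)_0=1$; $\binom{k+n-1}{n}$ is the ordinary binomial coefficient.
   Formalization: The left series diverges when aq ≠ 0 and |cq| ≥ 1, so the identity is asserted for those a, c for which the left series converges; its convergence is proved for |cq| < 1, and that of the right series always. *)

(* Defs.v *)
From mathcomp Require Import all_boot all_order all_algebra.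
From mathcomp Require Import complex.
From mathcomp Require Import all_classical all_reals all_analysis.
Import Order.TTheory GRing.Theory Num.Theory.
Import numFieldNormedType.Exports.

Set Implicit Arguments.
Unset Strict Implicit.
Unset Printing Implicit Defensive.

Local Open Scope ring_scope.
Local Open Scope complex_scope.

Definition qpoch (R : realType) (q x : R[i]) (n : nat) : R[i] :=
  \prod_(j < n) (1 - x * q ^+ j).

Definition lhs_term (R : realType) (q a c : R[i]) (N k n : nat) : R[i] :=
  c ^+ n * 'C(k + n - 1, n)%:R * (qpoch q (a * q ^+ n) N - 1).

(* The exponent N - n + 1 is an integer, negative once n > N + 1.  If q = 0 the
   total inverse makes such powers 0, and they are multiplied by
   q ^+ (n (n - 1) / 2) = 0. *)
Definition rhs_term (R : realType) (q a c : R[i]) (N k n : nat) : R[i] :=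
  (- a) ^+ n * q ^+ (n * (n - 1) %/ 2)
    / (qpoch q q n * (1 - c * q ^+ n) ^+ k)
    * qpoch q (q ^ (N%:Z - n%:Z + 1)) n.

(* R[i]^o is R[i] with the topology of the complex modulus. *)
Definition lhs_sum (R : realType) (q a c : R[i]) (N k m : nat) : R[i]^o :=
  \sum_(0 <= n < m) lhs_term q a c N k n.

Definition rhs_sum (R : realType) (q a c : R[i]) (N k m : nat) : R[i]^o :=
  \sum_(1 <= n < m) rhs_term q a c N k n.

(* Main.v *)
(** By the q-binomial theorem, [(a q^n; q)_N - 1] is a combination of the powers
    [(q^j)^n] for [1 <= j <= N].  Exchanging the sums turns the left-hand side
    into a combination of negative binomial series in [c q^j], which sum to
    [(1 - c q^j)^(-k)]; the terms of the right-hand side with [n > N] vanish.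
    If [|c q| >= 1], the left-hand side converges only for [a = 0]. *)
Require Import Defs.
From mathcomp Require Import all_boot all_order all_algebra.
From mathcomp Require Import complex.
From mathcomp Require Import all_classical all_reals all_analysis.
From mathcomp Require Import ring zify.
Import Order.TTheory GRing.Theory Num.Theory.
Import numFieldNormedType.Exports.

Local Open Scope ring_scope.
Local Open Scope complex_scope.

(** Multiplying by [1 - z] takes differences of coefficients, and Pascal's rule lowers [k.+1] to
    [k], up to one boundary term. Both the bound and the limit below follow from this by induction
    on [k]. *)
Lemma negbin_partial_sum {K : comPzRingType} (z : K) k m :
  (1 - z) * \sum_(n < m.+1) z ^+ n *+ 'C(k.+1 + n - 1, n)
  = \sum_(n < m.+1) z ^+ n *+ 'C(k + n - 1, n) - z ^+ m.+1 *+ 'C(k + m, m).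
Proof.
elim: m => [|m IH].
  by rewrite !big_ord_recr !big_ord0 /= !addn0 !bin0 !add0r expr0 mulr1 expr1.
rewrite big_ord_recr /= mulrDr {}IH [in RHS]big_ord_recr /=.
rewrite addSn subn1 /= !addnS subn1 /= binS !exprS mulrnDr.
ring.
Qed.

(** For [n <= N] this is $(q^{N-n+1};q)_n$ with its factors reversed, so that only natural exponents
    occur. For [n > N] the factor [i = N] is already [1 - q ^+ 0], so the truncated subtraction does
    no harm. *)
Definition qfall {K : pzRingType} (q : K) (N n : nat) : K :=
  \prod_(i < n) (1 - q ^+ (N - i)).

Lemma qfall_eq0 {K : pzRingType} (q : K) N n : (N < n)%N -> qfall q N n = 0.
Proof.
elim: n => // n IH; rewrite ltnS leq_eqVlt => /predU1P[->|/IH nN].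
  by rewrite /qfall big_ord_recr /= subnn expr0 subrr mulr0.
by rewrite /qfall big_ord_recr /= -/(qfall _ _ _) nN mul0r.
Qed.

Lemma qfallSr {K : pzRingType} (q : K) N n :
  qfall q N n.+1 = qfall q N n * (1 - q ^+ (N - n)).
Proof. by rewrite /qfall big_ord_recr. Qed.

Lemma qfallSS {K : pzRingType} (q : K) N n :
  qfall q N.+1 n.+1 = (1 - q ^+ N.+1) * qfall q N n.
Proof. by rewrite /qfall big_ord_recl. Qed.

(** * q-Pochhammer symbols and the q-binomial theorem *)

Section QPochhammer.
Context {R : realType} (q : R[i]).

Lemma qpoch0 x : qpoch q x 0 = 1.
Proof. by rewrite /qpoch big_ord0. Qed.

Lemma qpochSr x n : qpoch q x n.+1 = qpoch q x n * (1 - x * q ^+ n).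
Proof. by rewrite /qpoch big_ord_recr. Qed.

Lemma qpochSl x n : qpoch q x n.+1 = (1 - x) * qpoch q (x * q) n.
Proof.
rewrite /qpoch big_ord_recl expr0 mulr1; congr (_ * _).
by apply: eq_bigr => i _; rewrite exprS mulrA.
Qed.

Lemma qpoch_qfall N n : (n <= N)%N ->
  qpoch q (q ^ (N%:Z - n%:Z + 1)) n = qfall q N n.
Proof.
move=> nN; rewrite /qpoch /qfall (reindex_inj rev_ord_inj) /=.
apply: eq_bigr => i _; rewrite subzn // -PoszD -exprnP -exprD.
have iN := ltn_ord i.
by have -> : (N - n + 1 + (n - i.+1) = N - i)%N by lia.
Qed.

Hypothesis q1 : `|q| < 1.

Lemma one_subX_neq0 n : 1 - q ^+ n.+1 != 0.
Proof.
rewrite subr_eq0; apply: contraTneq isT => e.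
have : `|q ^+ n.+1| < 1 by rewrite normrX exprn_ilt1.
by rewrite -e normr1 ltxx.
Qed.

Lemma qpoch_neq0 n : qpoch q q n != 0.
Proof.
elim: n => [|n IH]; first by rewrite qpoch0 oner_eq0.
by rewrite qpochSr mulf_neq0 // -exprS one_subX_neq0.
Qed.

(** The Gaussian binomial coefficient. *)
Let qbin N n := qfall q N n / qpoch q q n.

Let qbin_pascal N n : qbin N.+1 n.+1 = qbin N n + q ^+ n.+1 * qbin N n.+1.
Proof.
rewrite /qbin qfallSS qfallSr qpochSr -exprS.
have [nN|Nn] := leqP n N; last by rewrite qfall_eq0 //; ring.
(* Splitting $q^{N+1}=q^{n+1}q^{N-n}$ reduces the claim to
   $1-q^{N+1}=(1-q^{n+1})+q^{n+1}(1-q^{N-n})$. *)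
rewrite -{1}(subnKC nN) -addSn exprD.
by have := qpoch_neq0 n; have := one_subX_neq0 n => *; field; apply/andP.
Qed.

(** Induction on [N] through $(x)_{N+1}=(1-x)(xq)_N$: the two products with [1] and [- x] match the
    two terms of the q-Pascal rule. *)
Lemma qbinomial x N : qpoch q x N =
  \sum_(n < N.+1) (- x) ^+ n * q ^+ 'C(n, 2) * (qfall q N n / qpoch q q n).
Proof.
elim: N x => [|N IH] x.
  by rewrite big_ord1 qpoch0 qpoch0 /qfall big_ord0 invr1 !mulr1.
rewrite qpochSl IH mulrDl mul1r [X in X + _]big_ord_recl [RHS]big_ord_recl /=.
under [in RHS]eq_bigr => i _ do
  rewrite -!/(qbin _ _) /bump /= add1n qbin_pascal mulrDr.
rewrite big_split /=.
rewrite [X in _ = _ + (_ + X)]big_ord_recr /= /qbin (qfall_eq0 q _ _ (ltnSn N)) mul0r !mulr0 addr0.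
rewrite -addrA; congr (_ + _).
  by rewrite /qfall !big_ord0.
rewrite addrC; congr (_ + _); last first.
  apply: eq_bigr => i _; rewrite /bump /= add1n -mulNr exprMn; ring.
rewrite mulr_sumr; apply: eq_bigr => i _.
rewrite -mulNr exprMn binS bin1 exprD exprS; ring.
Qed.

End QPochhammer.

Lemma negbin_partial_sum_le {R : realFieldType} (s : R) k m : 0 <= s < 1 ->
  \sum_(n < m.+1) s ^+ n *+ 'C(k + n - 1, n) <= (1 - s) ^- k.
Proof.
move=> /andP[s0 s1]; elim: k => [|k IH].
  rewrite big_ord_recl big1 /= ?addr0 ?expr0 ?invr1 // => i _.
  by rewrite bin_small ?mulr0n // /bump /=; lia.
have s10 : 0 < 1 - s by rewrite subr_gt0.
rewrite exprS invfM ler_pdivlMl // negbin_partial_sum.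
apply: le_trans IH.
by rewrite gerBl mulrn_wge0 // exprn_ge0.
Qed.

(** * Limits of complex sequences and the negative binomial series *)

Section ComplexSequences.
Context {R : realType}.
Implicit Types (z : R[i]) (f : nat -> R[i]^o).

Local Open Scope classical_set_scope.

Lemma cvg0_dominated f (g : nat -> R) :
  (forall n, `|f n| <= (g n)%:C) -> g @ \oo --> 0 -> f @ \oo --> 0.
Proof.
move=> fg g0; apply/cvgr0Pnorm_lt => e e0.
have eE := RRe_real (gtr0_real e0); move: e0; rewrite -eE ltcR => e0.
have /cvgr0Pnorm_lt/(_ _ e0) := g0.
apply: filterS => n gn; apply: le_lt_trans (fg n) _; rewrite ltcR.
exact: le_lt_trans (ler_norm _) gn.
Qed.

Lemma cvg_sumC (I : Type) (r : seq I) (F : I -> nat -> R[i]^o) (l : I -> R[i]^o) :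
  (forall i, F i @ \oo --> l i) ->
  (fun n => \sum_(i <- r) F i n) @ \oo --> \sum_(i <- r) l i.
Proof. by move=> Fl; apply: cvg_big => // *; exact: add_continuous. Qed.

Let Re_norm z : (complex.Re `|z|)%:C = `|z|.
Proof. by rewrite RRe_real // normr_real. Qed.

Let Re_norm_lt1 z : `|z| < 1 -> 0 <= complex.Re `|z| < 1.
Proof. by move=> z1; rewrite -ler0c -ltcR Re_norm normr_ge0. Qed.

Lemma cvg_binX z k : `|z| < 1 ->
  (fun n => z ^+ n *+ 'C(k + n, n) : R[i]^o) @ \oo --> (0 : R[i]^o).
Proof.
move=> /Re_norm_lt1/andP[]; set r := complex.Re _ => r0 r1.
(* With [s] strictly between [r] and 1, the binomial times [s ^+ n] stays bounded, which leaves the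
   geometric decay of [(r / s) ^+ n]. *)
have [s rs s1] : exists2 s, r < s & s < 1 by exists ((r + 1) / 2); rewrite midf_lt.
pose t := r / s.
have s0 : 0 < s := le_lt_trans r0 rs.
apply: (@cvg0_dominated _ (fun n => (1 - s) ^- k.+1 * t ^+ n)).
  move=> n; rewrite normrMn normrX -Re_norm -/r -rmorphXn -rmorphMn lecR.
  rewrite -[r](divfK (lt0r_neq0 s0)) -/t exprMn -mulrnAr mulrC.
  rewrite ler_wpM2r ?exprn_ge0 ?divr_ge0 ?(ltW s0) //.
  have s01 : 0 <= s < 1 by rewrite ltW.
  apply: le_trans (negbin_partial_sum_le s k.+1 n s01); rewrite big_ord_recr /= addSn subn1 /= lerDr.
  by apply: sumr_ge0 => i _; rewrite mulrn_wge0 // exprn_ge0 // ltW.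
rewrite -[X in _ --> X](mulr0 ((1 - s) ^- k.+1)).
apply: cvgMl_tmp; apply: cvg_expr.
by rewrite ger0_norm ?divr_ge0 ?(ltW s0) // ltr_pdivrMr // mul1r.
Qed.

Lemma cvg_exprC z : `|z| < 1 -> (fun n => z ^+ n : R[i]^o) @ \oo --> (0 : R[i]^o).
Proof.
move=> z1; have := cvg_binX z 0 z1.
by under eq_cvg do rewrite add0n binn mulr1n.
Qed.

(** Dividing [negbin_partial_sum] by [1 - z] gives the induction on [k]; the boundary term tends to
    0 by [cvg_binX]. *)
Lemma negbin_series z k : `|z| < 1 ->
  (fun m => \sum_(n < m) z ^+ n *+ 'C(k + n - 1, n) : R[i]^o) @ \oo
    --> ((1 - z) ^- k : R[i]^o).
Proof.
move=> z1; rewrite -cvg_shiftS /=; elim: k => [|k IH].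
  apply: cvg_near_cst; near=> m.
  rewrite big_ord_recl big1 /= ?addr0 ?expr0 ?invr1 // => i _.
  by rewrite bin_small ?mulr0n // /bump /=; lia.
have z10 : 1 - z != 0.
  by rewrite subr_eq0; apply: contraTneq z1 => <-; rewrite normr1 ltxx.
under eq_cvg => m do
  rewrite -[\sum_(_ < _) _](mulKf z10) negbin_partial_sum exprS -mulrnAr.
rewrite exprS invfM; apply: (@cvgMl_tmp R[i]^o).
rewrite -[X in _ --> X]subr0 -[X in _ - X](mulr0 z).
apply: (@cvgB _ R[i]^o); first exact: IH.
apply: (@cvgMl_tmp R[i]^o).
exact: (cvg_binX z k z1).
Unshelve. all: by end_near. Qed.

End ComplexSequences.

(** * Limits of the two sides and their equality *)

Section Theorem1p18.
Context {R : realType} (q a c : R[i]) (N k : nat).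
Hypothesis q1 : `|q| < 1.

Local Open Scope classical_set_scope.

(* The coefficient of [x ^+ n.+1] in [(a x; q)_N]. *)
Let B n : R[i] :=
  (- a) ^+ n.+1 * q ^+ 'C(n.+1, 2) * (qfall q N n.+1 / qpoch q q n.+1).

(** The [- 1] cancels the constant term of the q-binomial expansion, hence the shifted index in
    [B]. *)
Let lhs_termE n : lhs_term q a c N k n =
  \sum_(j < N) B j * ((c * q ^+ j.+1) ^+ n *+ 'C(k + n - 1, n)).
Proof.
rewrite /lhs_term qbinomial // big_ord_recl /= {1}/qfall big_ord0 qpoch0.
rewrite invr1 !mulr1 expr0 addrAC subrr add0r mulr_sumr; apply: eq_bigr => j _.
rewrite /B /bump /= add1n -mulNr !exprMn -!exprM [(j.+1 * n)%N]mulnC -mulr_natr.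
ring.
Qed.

Let lhs_sumE m : lhs_sum q a c N k m =
  \sum_(j < N) B j * \sum_(n < m) (c * q ^+ j.+1) ^+ n *+ 'C(k + n - 1, n).
Proof.
rewrite /lhs_sum big_mkord; under eq_bigr => n _ do rewrite lhs_termE.
by rewrite exchange_big; apply: eq_bigr => j _; rewrite mulr_sumr.
Qed.

Let rhs_termE n : (n < N)%N ->
  rhs_term q a c N k n.+1 = B n / (1 - c * q ^+ n.+1) ^+ k.
Proof.
move=> nN; rewrite /rhs_term qpoch_qfall // divn2 subn1 -bin2 /B invfM; ring.
Qed.

Let rhs_term_eq0 n : (0 < N < n)%N -> rhs_term q a c N k n = 0.
Proof.
move=> /andP[N0 Nn]; rewrite /rhs_term; have [->|q0] := eqVneq q 0.
  (* Since [0 < N < n] gives [n >= 2], the power of [q = 0] has a positive exponent and vanishes. *)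
  have n2 : (0 < 'C(n, 2))%N by rewrite bin_gt0; lia.
  by rewrite divn2 subn1 -bin2 expr0n eqn0Ngt n2 mulr0 !mul0r.
(* The factor of this index is [1 - q ^ 0], since $(N-n+1)+(n-N-1)=0$. *)
have jn : (n - N.+1 < n)%N by lia.
rewrite [qpoch _ (_ ^ _) _](bigD1 (Ordinal jn)) //= [q ^+ (n - N.+1)]exprnP -expfzDr //.
have -> : (N%:Z - n%:Z + 1 + (n - N.+1)%N%:Z)%R = 0 by lia.
by rewrite expr0z subrr mul0r mulr0.
Qed.

Lemma rhs_sum_cvg : (0 < N)%N -> rhs_sum q a c N k @ \oo -->
  (\sum_(j < N) B j / (1 - c * q ^+ j.+1) ^+ k : R[i]^o).
Proof.
move=> N0; apply: cvg_near_cst; near=> m.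
(* From here on the partial sums are constant. *)
have Nm : (N.+1 <= m)%N by near: m; exact: nbhs_infty_ge.
rewrite /rhs_sum (big_cat_nat _ Nm) //= [X in _ + X]big_nat [X in _ + X]big1 ?addr0; last first.
  by move=> n /andP[Nn _]; rewrite rhs_term_eq0 // N0.
rewrite big_add1 big_mkord; apply: eq_bigr => j _; exact: rhs_termE.
Unshelve. all: by end_near. Qed.

Let normX_cqS j : `|c * q| < 1 -> `|c * q ^+ j.+1| < 1.
Proof.
move=> cq1; rewrite exprS mulrA normrM normrX.
by rewrite (le_lt_trans _ cq1) // ler_piMr // exprn_ile1 // ltW.
Qed.

Lemma lhs_sum_cvg : `|c * q| < 1 -> lhs_sum q a c N k @ \oo -->
  (\sum_(j < N) B j / (1 - c * q ^+ j.+1) ^+ k : R[i]^o).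
Proof.
move=> cq1; under eq_cvg do rewrite lhs_sumE.
apply: cvg_sumC => j; apply: (@cvgMl_tmp R[i]^o).
by apply: negbin_series; exact: normX_cqS.
Qed.

(* Divided by [(c q) ^+ n] times a binomial, of modulus at least 1, the general
   term tends to its coefficient at [j = 0]. *)
Lemma cvgn_lhs_sum_eq0 : (0 < N)%N -> (0 < k)%N -> 1 <= `|c * q| ->
  cvgn (lhs_sum q a c N k) -> a = 0.
Proof.
move=> N0 k0 cq1 /(@cvg_series_cvg_0 R[i] R[i]^o (lhs_term q a c N k)) t0.
pose u n : R[i]^o := \sum_(j < N) B j * (q ^+ j) ^+ n.
have tE n : lhs_term q a c N k n = (c * q) ^+ n *+ 'C(k + n - 1, n) * u n.
  rewrite lhs_termE mulr_sumr; apply: eq_bigr => j _.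
  by rewrite exprS mulrA exprMn -mulrnAl mulrCA.
have u0 : u @ \oo --> (0 : R[i]^o).
  apply/cvgr0Pnorm_lt => e e0; have /cvgr0Pnorm_lt/(_ _ e0) := t0.
  apply: filterS => n; apply: le_lt_trans; rewrite tE normrM ler_peMl //.
  (* The binomial is at least 1 because [k > 0]. *)
  rewrite normrMn normrX -[1]mulr1n; apply: le_trans (_ : 1 *+ 'C(k + n - 1, n) <= _).
    by rewrite ler_nat bin_gt0; lia.
  by rewrite lerMn2r exprn_ege1 ?orbT.
have uB : u @ \oo --> (\sum_(j < N) B j * (j == 0 :> nat)%:R : R[i]^o).
  apply: cvg_sumC => j; apply: (@cvgMl_tmp R[i]^o).
  have [->|j0] := posnP (j : nat).
    by apply: cvg_near_cst; near=> n; rewrite expr1n.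
  by apply: cvg_exprC; rewrite normrX exprn_ilt1 -?lt0n.
have : \sum_(j < N) B j * (j == 0 :> nat)%:R = 0 :> R[i]^o.
  have hR := @norm_hausdorff _ R[i]^o.
  by rewrite -(cvg_lim hR uB); exact: (cvg_lim hR u0).
rewrite (bigD1 (Ordinal N0)) //= mulr1 big1 ?addr0; last first.
  by move=> j; rewrite -val_eqE /= => /negbTE ->; rewrite mulr0.
(* The coefficient is $-a(1-q^N)/(1-q)$, and $q^N\neq 1$ because [N > 0]. *)
move=> /eqP; rewrite /B expr1 bin_small // expr0 mulr1.
rewrite mulf_eq0 mulf_eq0 invr_eq0 (negbTE (qpoch_neq0 _ q1 _)) orbF.
rewrite /qfall big_ord1 subn0 oppr_eq0.
have := one_subX_neq0 _ q1 N.-1; rewrite prednK // => /negbTE ->.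
by rewrite orbF => /eqP.
Unshelve. all: by end_near. Qed.

Lemma lim_lhs_sum_rhs_sum : (0 < N)%N -> (0 < k)%N ->
  cvgn (lhs_sum q a c N k) ->
  limn (lhs_sum q a c N k) = limn (rhs_sum q a c N k).
Proof.
move=> N0 k0 cvl; have hR := @norm_hausdorff _ R[i]^o.
rewrite (cvg_lim hR (rhs_sum_cvg N0)); apply: (cvg_lim hR).
have [cq1|cq1] := real_ltP (normr_real (c * q)) (real1 _).
  exact: lhs_sum_cvg.
(* Convergence now forces [a = 0], and every [B j] carries a positive power of [- a], so both limits
   are 0. *)
have B0 j : B j = 0.
  by rewrite /B (cvgn_lhs_sum_eq0 N0 k0 cq1 cvl) oppr0 expr0n !mul0r.
apply: cvg_near_cst; near=> m; rewrite lhs_sumE.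
by apply: eq_bigr => j _; rewrite B0 !mul0r.
Unshelve. all: by end_near. Qed.

End Theorem1p18.

Theorem theorem1p18 (R : realType) (N k : nat) (a c q : R[i])
    (hN : (0 < N)%N) (hk : (1 <= k)%N) (hq : `|q| < 1) :
  [/\ `|c * q| < 1 -> cvgn (lhs_sum q a c N k),
      cvgn (rhs_sum q a c N k)
    & cvgn (lhs_sum q a c N k) ->
      limn (lhs_sum q a c N k) = limn (rhs_sum q a c N k)].
Proof.
split; last exact: lim_lhs_sum_rhs_sum.
  by move=> cq1; apply/cvg_ex; eexists; exact: lhs_sum_cvg.
by apply/cvg_ex; eexists; exact: rhs_sum_cvg.
Qed.
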